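(* There is a quadratical quasigroup $G_{29}$ of order $29$ which is of form $Q7$ with respect to some distinct elements $a,b$, such that, writing $nk$ (for $1\le n\le 7$, $1\le k\le 4$) for its elements $[n,k]$ determined by $a,b$, and ordering its elements as $$11,14,44,34,42,74,21,22,64,13,53,72,63,54,33,aba,32,51,62,73,52,12,61,23,24,71,43,31,41,$$ the sequence $$11,12,54,74,43,62,53,44,23,aba,22,41,52,63,42,71,51,13,14,61,33,21,31,73,72,34,24,32,64$$ is a $12$-translatable sequence for $G_{29}$. Moreover the dual groupoid $(G_{29})^*$ is $17$-translatable (for some ordering of its elements).
   Context: A groupoid is a nonempty set with a binary operation. A groupoid $G$ is right solvable if for all $a,b\in G$ there is a unique $x\in G$ with $ax=b$. It has property A if $(xy)x=(zx)(yz)$ for all $x,y,z\in G$. A quadratical quasigroup is a right solvable groupoid with property A (such a groupoid is known to be a quasigroup). In a quadratical quasigroup $x(yx)=(xy)x$, written $xyx$. Given distinct $a,b$ in a quadratical quasigroup $Q$, define elements $[n,k]$ (abbreviated $nk$, two symbols, not a decimal number) for $n\ge 1$, $k\in\{1,2,3,4\}$ by $[1,1]=a$, $[1,2]=ab$, $[1,3]=ba$, $[1,4]=b$, and for $n\ge2$: $[n,1]=[n-1,1]\cdot[n-1,2]$, $[n,2]=[n-1,2]\cdot[n-1,4]$, $[n,3]=[n-1,3]\cdot[n-1,1]$, $[n,4]=[n-1,4]\cdot[n-1,3]$. Put $Hn=\{[n,1],[n,2],[n,3],[n,4]\}$. $Q$ is of form $Qn$ (with respect to $a,b$) if $Q=\{aba\}\cup\bigcup_{i=1}^n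 Hi$ with $H1,\dots,Hn$ pairwise disjoint, so that $|Q|=4n+1$. For a finite groupoid with elements listed in an order $e_1,\dots,e_m$ and $k\in\{1,\dots,m\}$, a sequence $x_1,\dots,x_m$ is a $k$-translatable sequence (for this ordering) if $e_1e_j=x_j$ for all $j$, and for each $q\in\{2,\dots,m\}$ row $q$ of the Cayley table is obtained from row $q-1$ by moving its last $k$ entries, in order, to the front; i.e. $e_qe_j=e_{q-1}e_{j'}$ where $j'\in\{1,\dots,m\}$, $j'\equiv j-k\pmod m$. A groupoid is $k$-translatable if it has a $k$-translatable sequence for some ordering. The dual of $(G,\cdot)$ is $G^*=(G,* )$ with $x*y=y\cdot x$. *)

(* Defs.v *)
From mathcomp Require Import all_boot.

Set Implicit Arguments.
Unset Strict Implicit.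
Unset Printing Implicit Defensive.

(* A groupoid (magma) is an inhabited carrier T with an operation op. *)

Section Groupoids.

Variables (T : Type) (op : T -> T -> T).
Local Notation "x * y" := (op x y).

Definition right_solvable : Prop := forall a b : T, exists! x : T, a * x = b.

Definition propertyA : Prop :=
  forall x y z : T, (x * y) * x = (z * x) * (y * z).

Definition quadratical_quasigroup : Prop :=
  [/\ inhabited T, right_solvable & propertyA].

Definition dual (x y : T) : T := y * x.

(* [n, k], meaningful only for 1 <= n and 1 <= k <= 4: every other k is read
   as 4, and n = 0 gives the junk value a. *)
Fixpoint elt (a b : T) (n k : nat) : T :=
  match n with
  | 0 => a
  | 1 => match k with
         | 1 => a
         | 2 => a * b
         | 3 => b * a
         | _ => b
         end
  | p.+1 => match k with
            | 1 => elt a b p 1 * elt a b p 2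
            | 2 => elt a b p 2 * elt a b p 4
            | 3 => elt a b p 3 * elt a b p 1
            | _ => elt a b p 4 * elt a b p 3
            end
  end.

(* The element written aba; in a quadratical quasigroup it is also
   a * (b * a). *)
Definition aba (a b : T) : T := (a * b) * a.

End Groupoids.

Section FiniteGroupoids.

Variables (T : finType) (op : T -> T -> T).

Definition H (a b : T) (n : nat) : {set T} :=
  [set elt op a b n 1; elt op a b n 2; elt op a b n 3; elt op a b n 4].

Definition of_form_Q (n : nat) (a b : T) : Prop :=
  [set: T] = aba op a b |: \bigcup_(1 <= i < n.+1) H a b i /\
  (forall i j : nat, 1 <= i <= n -> 1 <= j <= n -> i != j ->
     [disjoint H a b i & H a b j]).

Definition ordering (e : seq T) : Prop := uniq e /\ forall x : T, x \in e.

Definition cayley_row (e : seq T) (y : T) : seq T := [seq op y z | z <- e].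

(* Rows are indexed from 0; rotr k moves the last k entries to the front.
   The default value d of nth is never reached. *)
Definition translatable_seq (k : nat) (e x : seq T) : Prop :=
  [/\ ordering e,
      1 <= k <= size e,
      forall d : T, cayley_row e (nth d e 0) = x &
      forall (d : T) (q : nat), q.+1 < size e ->
        cayley_row e (nth d e q.+1) = rotr k (cayley_row e (nth d e q))].

Definition translatable (k : nat) : Prop :=
  exists e x : seq T, translatable_seq k e x.

End FiniteGroupoids.

(* Main.v *)
Require Import Defs.
From mathcomp Require Import all_boot.
From mathcomp Require Import all_algebra ring.

(** Let [t] be an element of a commutative ring with [2 t ^ 2 - 2 t + 1 = 0].
    The affine operation [x * y = x + t (y - x)] is then a quadratical
    quasigroup: both sides of property A are affine combinations of [x], [y]
    and [z], and comparing coefficients leaves exactly that equation, which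
    also makes [t] invertible with inverse [2 (1 - t)].

    Over the integers modulo [n], listed as [0, 1, ..., n - 1], the
    [k]-translatability of this operation says that the product is unchanged
    when the left factor grows by [1] and the right factor by [k], that is,
    [1 - t + t k = 0].  The equation for [t] says that [k = 2 t - 1] is a
    solution.  The dual of the affine operation for [t] is the one for
    [1 - t], a second root of the same equation, so the dual is translatable
    for [2 (1 - t) - 1 = - k], that is, for [n - k].

    The theorem is the case [n = 29], [t = 21], hence [k = 12] and
    [n - k = 17].  With [a = 0] and [b = 1] the ordering in the statement,
    11, 14, 44, ..., 31, 41, is precisely [0, 1, ..., 28], and the proposed
    sequence is the row [0, t, 2 t, ..., 28 t] of [0], so only those two lists
    and the form Q7 are left to be computed. *)

Set Implicit Arguments.
Unset Strict Implicit.
Unset Printing Implicit Defensive.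

Import GRing.Theory.

Section AffineGroupoid.

Local Open Scope ring_scope.

Variable R : comNzRingType.
Implicit Types t x y z : R.

Definition affine_op t x y : R := x + t * (y - x).

Definition quadratical_root t : Prop := t ^+ 2 *+ 2 - t *+ 2 + 1 = 0.

Lemma quadratical_root_dual t : quadratical_root t -> quadratical_root (1 - t).
Proof. by rewrite /quadratical_root => <-; ring. Qed.

Lemma dual_affine_op t : dual (affine_op t) =2 affine_op (1 - t).
Proof. by move=> x y; rewrite /dual /affine_op; ring. Qed.

Lemma affine_op_right_solvable t :
  quadratical_root t -> right_solvable (affine_op t).
Proof.
(* The equation for t, read as t * (2 * (1 - t)) = 1, inverts t. *)
move=> ht; have tV : t * ((1 - t) *+ 2) = 1.
  by rewrite -[RHS]subr0 -ht; ring.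
move=> a b; exists (a + (1 - t) *+ 2 * (b - a)); split=> [|x <-].
  rewrite /affine_op.
  have -> : a + t * (a + (1 - t) *+ 2 * (b - a) - a)
          = a + (t * ((1 - t) *+ 2)) * (b - a) by ring.
  by rewrite tV; ring.
rewrite /affine_op.
have -> : a + (1 - t) *+ 2 * (a + t * (x - a) - a)
        = a + (t * ((1 - t) *+ 2)) * (x - a) by ring.
by rewrite tV; ring.
Qed.

Lemma affine_op_propertyA t : quadratical_root t -> propertyA (affine_op t).
Proof.
move=> ht x y z; apply/eqP; rewrite -subr_eq0; apply/eqP.
transitivity ((t ^+ 2 *+ 2 - t *+ 2 + 1) * (x - z)); last by rewrite ht mul0r.
by rewrite /affine_op; ring.
Qed.

Lemma affine_op_quadratical t :
  quadratical_root t -> quadratical_quasigroup (affine_op t).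
Proof.
move=> ht; split; first exact: (inhabits 0).
- exact: affine_op_right_solvable.
- exact: affine_op_propertyA.
Qed.

(** The diagonal shift [(1, k)] leaves the product unchanged; this is
    [k]-translatability at the level of single entries. *)
Lemma affine_op_shift t x y :
  quadratical_root t ->
  affine_op t (x + 1) (y + (t *+ 2 - 1)) = affine_op t x y.
Proof.
move=> ht; apply/eqP; rewrite -subr_eq0; apply/eqP.
by rewrite -ht /affine_op; ring.
Qed.

End AffineGroupoid.

Section NaturalOrder.

Local Open Scope ring_scope.

Variable n : nat.
Hypothesis n_gt1 : (1 < n)%N.

Definition natural_order : seq 'Z_n := [seq i%:R | i <- iota 0 n].

Lemma size_natural_order : size natural_order = n.
Proof. by rewrite size_map size_iota. Qed.

Lemma card_Zmod : #|'Z_n| = n.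
Proof. by rewrite card_ord Zp_cast. Qed.

Lemma nth_natural_order d i : (i < n)%N -> nth d natural_order i = i%:R.
Proof.
by move=> lt_in; rewrite (nth_map 0%N) ?size_iota // nth_iota.
Qed.

Lemma natural_order_ordering : ordering natural_order.
Proof.
have in_order x : x \in natural_order.
  apply/mapP; exists (val x); last by rewrite natr_Zp.
  by rewrite mem_iota /= add0n -[X in (_ < X)%N](Zp_cast n_gt1).
split=> //; apply/card_uniqP; rewrite size_natural_order -[RHS]card_Zmod.
by apply: eq_card => x; rewrite in_order.
Qed.

(** A rotation of the list is an addition in the cyclic group, because the
    entries that leave the front reappear at the end as [n, n + 1, ...]. *)
Lemma rot_natural_order k :
  (k <= n)%N -> rot k natural_order = [seq x + k%:R | x <- natural_order].
Proof.
move=> le_kn; rewrite -map_rot -map_comp /rot drop_iota take_iota add0n.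
rewrite (minn_idPl le_kn) map_cat.
have -> : [seq i%:R | i <- iota 0 k] = [seq i%:R | i <- iota n k] :> seq 'Z_n.
  have -> : iota n k = [seq (n + i)%N | i <- iota 0 k] by rewrite -iotaDl addn0.
  by rewrite -map_comp; apply: eq_map => i /=; rewrite natrD pchar_Zp // add0r.
have -> : iota n k = iota (k + (n - k)) k by rewrite subnKC.
rewrite -map_cat -iotaD subnK //.
have -> : iota k n = [seq (k + i)%N | i <- iota 0 n] by rewrite -iotaDl addn0.
by rewrite -map_comp; apply: eq_map => i /=; rewrite natrD addrC.
Qed.

(** Shifting the columns by [k] compensates a unit step in the rows, so a row
    rotated left by [k] is the preceding one. *)
Lemma affine_op_translatable_seq (t : 'Z_n) k :
  quadratical_root t -> k%:R = t *+ 2 - 1 -> (1 <= k <= n)%N ->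
  translatable_seq (affine_op t) k natural_order
                   (cayley_row (affine_op t) natural_order 0).
Proof.
move=> ht kE k_bounds; have /andP[_ le_kn] := k_bounds.
split; first exact: natural_order_ordering.
- by rewrite size_natural_order.
- by move=> d; rewrite nth_natural_order // ltnW.
move=> d q; rewrite size_natural_order => lt_qn.
rewrite !nth_natural_order ?(ltnW lt_qn) //.
apply: (canRL (rotK k)).
rewrite /cayley_row -map_rot rot_natural_order // -map_comp.
by apply: eq_map => y /=; rewrite -natr1 kE affine_op_shift.
Qed.

Lemma dual_affine_op_translatable (t : 'Z_n) k :
  quadratical_root t -> k%:R = t *+ 2 - 1 -> (k < n)%N ->
  translatable (dual (affine_op t)) (n - k).
Proof.
move=> ht kE lt_kn; have ht' := quadratical_root_dual ht.
have k'E : (n - k)%:R = (1 - t) *+ 2 - 1 :> 'Z_n.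
  rewrite natrB ?(ltnW lt_kn) // pchar_Zp // kE; ring.
have k'_bounds : (1 <= n - k <= n)%N by rewrite subn_gt0 lt_kn leq_subr.
have [ord_e bnd row0 rowS] := affine_op_translatable_seq ht' k'E k'_bounds.
have dual_row y : cayley_row (dual (affine_op t)) natural_order y
                = cayley_row (affine_op (1 - t)) natural_order y.
  by apply: eq_map => z; apply: dual_affine_op.
exists natural_order, (cayley_row (affine_op (1 - t)) natural_order 0).
by split=> // [d|d q ltq]; rewrite !dual_row ?row0 ?rowS.
Qed.

End NaturalOrder.

Section FormQ.

Variables (T : finType) (op : T -> T -> T) (a b : T).

Definition Hseq i : seq T := [seq elt op a b i k | k <- [:: 1; 2; 3; 4]].

Lemma mem_Hseq i x : (x \in H op a b i) = (x \in Hseq i).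
Proof. by rewrite !inE !orbA. Qed.

(** By counting, it is enough to see that the [4 n + 1] listed elements are
    distinct; this trades statements about sets for one decidable by
    computation. *)
Lemma of_form_Q_uniq n :
  uniq (aba op a b :: flatten [seq Hseq i | i <- iota 1 n]) ->
  #|T| = (4 * n).+1 -> of_form_Q op n a b.
Proof.
set s := flatten _ => uniq_cs cardT.
have mem_s x : (x \in s) = [exists i : 'I_n.+1, (0 < i) && (x \in Hseq i)].
  apply/flatten_mapP/existsP => [[i]|[i /andP[i_gt0 xi]]].
    rewrite mem_iota add1n => /andP[i_gt0 lt_in] xi.
    by exists (Ordinal lt_in); rewrite /= i_gt0.
  by exists (val i) => //; rewrite mem_iota add1n i_gt0 ltn_ord.
have size_s : size s = (4 * n).
  rewrite /s size_flatten /shape -map_comp.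
  rewrite (eq_map (_ : _ =1 fun=> 4)) //.
  by rewrite -[n in RHS](size_iota 1) mulnC; elim: iota => //= _ r ->.
have all_cs x : x \in aba op a b :: s.
  have /card_uniqP card_cs := uniq_cs.
  have eq_cs : #|aba op a b :: s| = #|T| by rewrite card_cs /= size_s cardT.
  by rewrite (subset_cardP eq_cs (subset_predT _)).
split.
  apply/setP => x; rewrite in_setT; apply/esym.
  have := all_cs x; rewrite in_cons !inE => /orP[->//|].
  rewrite mem_s => /existsP[i /andP[i_gt0 xi]]; apply/orP; right.
  have i_range : val i \in index_iota 1 n.+1.
    by rewrite mem_index_iota i_gt0 ltn_ord.
  by rewrite (bigD1_seq _ i_range (iota_uniq _ _)) in_setU mem_Hseq xi.
have disj i j : (0 < i) -> (i < j <= n) -> [disjoint H op a b i & H op a b j].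
  move=> i_gt0 /andP[lt_ij le_jn].
  have j_gt0 : 0 < j by apply: leq_ltn_trans lt_ij.
  (* Splitting the flattened list just before block j puts the two blocks into
     different halves of a duplicate-free list. *)
  have split_iota : iota 1 n = iota 1 j.-1 ++ iota j (n - j.-1).
    have {2}-> : j = 1 + j.-1 by rewrite add1n prednK.
    by rewrite -iotaD subnKC // (leq_trans (leq_pred _)).
  have := uniq_cs; rewrite cons_uniq => /andP[_].
  rewrite /s split_iota map_cat flatten_cat cat_uniq => /and3P[_ /hasPn no_x _].
  apply/pred0P => x /=; rewrite !mem_Hseq; apply/negP => /andP[xi xj].
  have /no_x/negP[] : x \in flatten [seq Hseq k | k <- iota j (n - j.-1)].
    apply/flatten_mapP; exists j => //; rewrite mem_iota leqnn /=.
    by rewrite -[X in X < _]addn0 ltn_add2l subn_gt0 prednK.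
  apply/flatten_mapP; exists i => //.
  by rewrite mem_iota i_gt0 add1n prednK.
move=> i j /andP[i_gt0 le_in] /andP[j_gt0 le_jn].
by case: ltngtP => // lt_ _; [|rewrite disjoint_sym];
  apply: disj => //; apply/andP.
Qed.

End FormQ.

Theorem theorem8p8 :
  exists (T : finType) (op : T -> T -> T),
    quadratical_quasigroup op /\
    #|T| = 29 /\
    (exists a b : T,
       a <> b /\
       of_form_Q op 7 a b /\
       let E := elt op a b in
       let c := aba op a b in
       translatable_seq op 12
        [:: E 1 1; E 1 4; E 4 4; E 3 4; E 4 2; E 7 4; E 2 1; E 2 2;
            E 6 4; E 1 3; E 5 3; E 7 2; E 6 3; E 5 4; E 3 3; c;
            E 3 2; E 5 1; E 6 2; E 7 3; E 5 2; E 1 2; E 6 1; E 2 3;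
            E 2 4; E 7 1; E 4 3; E 3 1; E 4 1]
        [:: E 1 1; E 1 2; E 5 4; E 7 4; E 4 3; E 6 2; E 5 3; E 4 4;
            E 2 3; c; E 2 2; E 4 1; E 5 2; E 6 3; E 4 2; E 7 1;
            E 5 1; E 1 3; E 1 4; E 6 1; E 3 3; E 2 1; E 3 1; E 7 3;
            E 7 2; E 3 4; E 2 4; E 3 2; E 6 4]) /\
    translatable (dual op) 17.
Proof.
(* 12 is a square root of -1 modulo 29, and t is (1 + 12) / 2. *)
pose t : 'Z_29 := 21%:R%R.
have ht : quadratical_root t by apply/eqP; vm_compute.
have kE : (12%:R = t *+ 2 - 1)%R by apply/eqP; vm_compute.
have card29 : #|'Z_29| = 29 by rewrite card_Zmod.
exists 'Z_29, (affine_op t); split; first exact: affine_op_quadratical.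
split; first exact: card29.
split; last first.
  exact: (@dual_affine_op_translatable 29 isT t 12).
exists 0%R, 1%R; split; first by move/eqP.
split.
  by apply: of_form_Q_uniq; [vm_compute | exact: card29].
move=> E c.
have := @affine_op_translatable_seq 29 isT t 12 ht kE isT.
congr translatable_seq; apply/eqP; vm_compute; reflexivity.
Qed.
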